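(* Let $A$ be a real $n\times n$ positive semi-definite matrix with leading orthonormal eigenvectors $\varphi$ and $\psi$ corresponding to eigenvalues $\lambda$ and $\mu$ (so $A\varphi=\lambda\varphi$, $A\psi=\mu\psi$, with $\lambda$ and $\mu$ the first and second largest eigenvalues), where $\lambda>\mu$ and $r=\mu/\lambda>1/2$. Let $u_0=\varphi+c\,\psi$ with $c\in\mathbb{R}$, $c\neq 0$, and suppose $m\ge 1$ iterations of the power method are run from $u_0$ before switching to the simple extrapolation method (the combined iteration is written out in the context), where $m$ is large enough that $c^2 r^{2(m-1)}(1-r^2)<1$. Then for every $j\ge 1$ the extrapolation parameter $\gamma_{m+j}=-\|d_{m+j}\|/\|d_{m+j-1}\|$ and the accelerated iterate $u_{m+j+1}$ satisfy $$\gamma_{m+j}=-r^{j}\,(1+\varepsilon^d_{m+j}),\qquad \varepsilon^d_{m+j}=\mathcal{O}\left(r^{2(m-1)}\right),$$ $$u_{m+j+1}=\lambda\left\{(1+\hat\theta_{m+j+1})\,\varphi+c\,r^{\,m+\sum_{l=1}^{j+1}l}\,(1+\hat\eta_{m+j+1})\,\psi\right\},$$ for real numbers $\varepsilon^d_{m+j}$, $\hat\theta_{m+j+1}$, $\hat\eta_{m+j+1}$ with $$\hat\theta_{m+j+1}=\mathcal{O}\left(r^{2m+1}\right)\quad\text{and}\quad \hat\eta_{m+j+1}=\mathcal{O}\left(r^{2(m-1)}\right).$$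
   Context: Notation: $(u,v)=u^Tv$ on $\mathbb{R}^n$ and $\|\cdot\|$ is the induced Euclidean ($l_2$) norm. The combined iteration (run without a stopping test). Put $h_0=\|u_0\|$. Power phase: for $k=0,1,\dots,m$ set $x_k=h_k^{-1}u_k$, $\;u_{k+1}=v_{k+1}=Ax_k$, $\;h_{k+1}=\|u_{k+1}\|$, $\;\lambda_k=(u_{k+1},x_k)$, $\;d_{k+1}=u_{k+1}-\lambda_k x_k$. Extrapolation phase: for $k=m+1,m+2,\dots$ set $x_k=h_k^{-1}u_k$, $\;v_{k+1}=Ax_k$, $\;\gamma_k=-\|d_k\|/\|d_{k-1}\|$, $u_{k+1}=(1-\gamma_k)v_{k+1}+\gamma_k v_k$, $\;h_{k+1}=\|u_{k+1}\|$, $x_k^\gamma=(1-\gamma_k)x_k+\gamma_k x_{k-1}$, $\lambda_k=(u_{k+1},x_k^\gamma)/(x_k^\gamma,x_k^\gamma)$, $\;d_{k+1}=u_{k+1}-\lambda_k x_k^\gamma$. Thus $u_{m+2}$ is the first accelerated iterate and $\gamma_{m+1}$ the first extrapolation parameter. The scalars $\lambda_k$ (with index) are the computed Rayleigh quotients; $\lambda$ (without index) is the dominant eigenvalue of $A$. Order notation: a quantity is $\mathcal{O}(r^{p(m)})$ if its absolute value is at most $C\,r^{p(m)}$ with a constant $C$ that does not depend on $m$; here $A$, $c$ and $j$ are fixed (so $C$ may depend on them) and $m$ ranges over the admissible values for which the iteration is defined up to the iterate in question. *)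

(* Defs.v *)
From mathcomp Require Import all_boot all_order all_algebra.
From mathcomp Require Import reals.

Set Implicit Arguments.
Unset Strict Implicit.
Unset Printing Implicit Defensive.

Import Order.TTheory GRing.Theory Num.Theory.
Local Open Scope ring_scope.

Definition dotv (R : realType) (n : nat) (u v : 'cV[R]_n) : R :=
  (u^T *m v) 0 0.

Definition l2norm (R : realType) (n : nat) (u : 'cV[R]_n) : R :=
  Num.sqrt (dotv u u).

Definition psd (R : realType) (n : nat) (A : 'M[R]_n) : Prop :=
  A^T = A /\ forall x : 'cV[R]_n, 0 <= dotv x (A *m x).

(* mathcomp's [eigenvalue] refers to left (row) eigenvectors; for the symmetric
   matrices considered here this is the usual spectrum.  [mu] is the largest
   eigenvalue below [lam]; [lam] may have any multiplicity. *)
Definition first_two_eigenvalues (R : realType) (n : nat) (A : 'M[R]_n)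
    (lam mu : R) : Prop :=
  [/\ eigenvalue A lam, forall a, eigenvalue A a -> a <= lam,
      mu < lam, eigenvalue A mu
    & forall a, eigenvalue A a -> a < lam -> a <= mu].

(* Index conventions: [it_v 0], [it_d 0], and [it_gam k], [it_xg k] for
   [k <= m] are never used by the iteration and are left unconstrained by
   [combined_iteration]; [it_lam k] is the computed Rayleigh quotient. *)
Record iterates (R : realType) (n : nat) := Iterates {
  it_x : nat -> 'cV[R]_n;
  it_u : nat -> 'cV[R]_n;
  it_v : nat -> 'cV[R]_n;
  it_h : nat -> R;
  it_lam : nat -> R;
  it_d : nat -> 'cV[R]_n;
  it_gam : nat -> R;
  it_xg : nat -> 'cV[R]_n
}.

Definition power_step (R : realType) (n : nat) (A : 'M[R]_n)
    (I : iterates R n) (k : nat) : Prop :=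
  let: Iterates x u v h lam d _ _ := I in
  x k = (h k)^-1 *: u k /\
  v k.+1 = A *m x k /\
  u k.+1 = v k.+1 /\
  h k.+1 = l2norm (u k.+1) /\
  lam k = dotv (u k.+1) (x k) /\
  d k.+1 = u k.+1 - lam k *: x k.

Definition extrapolation_step (R : realType) (n : nat) (A : 'M[R]_n)
    (I : iterates R n) (k : nat) : Prop :=
  let: Iterates x u v h lam d gam xg := I in
  x k = (h k)^-1 *: u k /\
  v k.+1 = A *m x k /\
  gam k = - (l2norm (d k) / l2norm (d k.-1)) /\
  u k.+1 = (1 - gam k) *: v k.+1 + gam k *: v k /\
  h k.+1 = l2norm (u k.+1) /\
  xg k = (1 - gam k) *: x k + gam k *: x k.-1 /\
  lam k = dotv (u k.+1) (xg k) / dotv (xg k) (xg k) /\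
  d k.+1 = u k.+1 - lam k *: xg k.

(* Division being total, such [I] exist for all [A], [u0], [m]; that no division
   by zero occurs is the separate condition [defined_upto]. *)
Definition combined_iteration (R : realType) (n : nat) (A : 'M[R]_n)
    (u0 : 'cV[R]_n) (m : nat) (I : iterates R n) : Prop :=
  [/\ it_u I 0 = u0, it_h I 0 = l2norm u0,
      forall k, (k <= m)%N -> power_step A I k
    & forall k, (m < k)%N -> extrapolation_step A I k].

(* Every denominator entering the computation of [it_u I N] is nonzero.  The
   last condition stops one step earlier: the last Rayleigh quotient entering
   [it_u I N] is that of step [N - 2]. *)
Definition defined_upto (R : realType) (n : nat) (m : nat)
    (I : iterates R n) (N : nat) : Prop :=
  [/\ forall k, (k < N)%N -> it_h I k != 0,
      forall k, (m < k < N)%N -> l2norm (it_d I k.-1) != 0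
    & forall k, (m < k)%N -> (k.+1 < N)%N ->
        dotv (it_xg I k) (it_xg I k) != 0].

(* Main.v *)
Require Import Defs.
From mathcomp Require Import all_boot all_order all_algebra.
From mathcomp Require Import reals.
From mathcomp Require Import ring lra zify.
Import Order.TTheory GRing.Theory Num.Theory.
Local Open Scope ring_scope.

Set Implicit Arguments.
Unset Strict Implicit.
Unset Printing Implicit Defensive.

(** The iteration never leaves the plane spanned by [phi] and [psi], so every
    iterate is a pair of coordinates, and the theorem says how these depend on
    the number m = M + 1 of power steps when j is fixed.  To leading order
    only the ratio of the coordinates matters.  Write T_j = 1 + ... + j.  If
    x_(m+j) is close to phi + c r^(m+T_j) psi and gamma_(m+j) to - r^j, then
    - in the extrapolation (1 - gamma_(m+j)) x_(m+j) + gamma_(m+j) x_(m+j-1)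
      the leading psi-parts c r^(m+T_j) and - r^j c r^(m+T_(j-1)) cancel, since
      j + T_(j-1) = T_j; what is left is c r^(m+T_j+j) psi, and applying A
      turns the exponent into m + T_(j+1) ([vec_asymp_extrapolate],
      [vec_asymp_mul]);
    - for y close to phi + t psi with t small, the residual A y - rho(y) y
      has norm close to lam (1 - r) |t| ([l2norm_residual], [residual_asymp]),
      so consecutive residual norms have quotient close to r^(j+1), which is
      - gamma_(m+j+1) ([gam_asymp]).
    These two facts propagate by induction on j ([state_asympS]), starting from
    the explicit power iterates ([power_x]).

    All errors are relative: each quantity is its leading term times a factor
    1 + O(r^(2M)), because normalisations such as sqrt (1 + c^2 r^(2k)) differ
    from 1 by the square of the psi-coordinate.  The class [near_one] of such
    factors is closed under products, square roots, absolute values and, above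
    all, inverses ([near_oneV]): an inverse is controlled for large M, and the
    finitely many remaining M only enlarge the constant.  For this to give
    constants uniform over all runs, the factors are sequences in M alone,
    determined by A, c and j.  The bound on theta has the smaller power
    r^(2m+1) = r^3 r^(2M), but the ratio r^3 is absorbed by the constant. *)

(** * Sequences that are 1 + O(s^M) *)

Section NearOne.
Variables (R : realType) (s : R).
Hypotheses (s_ge0 : 0 <= s) (s_lt1 : s < 1).
Implicit Types f g e : nat -> R.

Definition bounded f := exists B, forall M, `|f M| <= B.

Definition geomO e := exists C, forall M, `|e M| <= C * s ^+ M.

Definition near_one f := geomO (fun M => f M - 1).

Lemma bounded_cst a : bounded (fun=> a).
Proof. by exists `|a|. Qed.

Lemma boundedM f g : bounded f -> bounded g -> bounded (fun M => f M * g M).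
Proof.
move=> [B hB] [D hD]; exists (B * D) => M.
by rewrite normrM ler_pM.
Qed.

Lemma geomO_ext e f : (forall M, e M = f M) -> geomO e -> geomO f.
Proof. by move=> ef [C hC]; exists C => M; rewrite -ef. Qed.

Lemma near_one_ext f g : (forall M, f M = g M) -> near_one f -> near_one g.
Proof. by move=> fg; apply: geomO_ext => M; rewrite fg. Qed.

Lemma near_one_cst1 : near_one (fun=> 1).
Proof. by exists 0 => M; rewrite subrr normr0 mul0r. Qed.

Lemma geomO_expr : geomO (fun M => s ^+ M).
Proof. by exists 1 => M; rewrite mul1r ger0_norm ?exprn_ge0. Qed.

Lemma geomOD e f : geomO e -> geomO f -> geomO (fun M => e M + f M).
Proof.
move=> [C hC] [D hD]; exists (C + D) => M.
by rewrite mulrDl (le_trans (ler_normD _ _)) ?lerD.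
Qed.

Lemma geomOMl f e : bounded f -> geomO e -> geomO (fun M => f M * e M).
Proof.
move=> [B hB] [C hC]; exists (B * C) => M.
by rewrite normrM -mulrA ler_pM.
Qed.

Lemma near_oneD f e : near_one f -> geomO e -> near_one (fun M => f M + e M).
Proof.
by move=> hf he; apply: geomO_ext (geomOD hf he) => M; ring.
Qed.

Lemma near_oneB f g : near_one f -> near_one g -> geomO (fun M => f M - g M).
Proof.
move=> hf hg; apply: geomO_ext (geomOD hf (geomOMl (bounded_cst (-1)) hg)).
by move=> M; ring.
Qed.

Lemma near_one_bounded f : near_one f -> bounded f.
Proof.
move=> [C hC]; exists (1 + C) => M.
have C0 : 0 <= C by have := le_trans (normr_ge0 _) (hC 0%N); rewrite expr0 mulr1.
rewrite -[f M](subrK 1) addrC (le_trans (ler_normD _ _)) // normr1 lerD2l.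
by rewrite (le_trans (hC M)) // ler_piMr // exprn_ile1 // ltW.
Qed.

Lemma near_oneM f g : near_one f -> near_one g -> near_one (fun M => f M * g M).
Proof.
move=> hf hg.
apply: geomO_ext (geomOD (geomOMl (near_one_bounded hf) hg) hf) => M.
ring.
Qed.

Lemma near_one_norm f : near_one f -> near_one (fun M => `|f M|).
Proof.
move=> [C hC]; exists C => M; apply: le_trans (hC M).
by rewrite -[X in `|f M| - X](@normr1 R) ler_dist_dist.
Qed.

(** For x >= 0, sqrt x - 1 = (x - 1) / (sqrt x + 1) with a denominator of at
    least 1; for x < 0 the root is 0 and x is further from 1 than 0 is. *)
Lemma sqrt_dist1 (x : R) : `|Num.sqrt x - 1| <= `|x - 1|.
Proof.
have [x0|x0] := leP 0 x; last first.
  rewrite ler0_sqrtr ?(ltW x0) // sub0r normrN normr1 ler0_norm; lra.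
have q0 := sqrtr_ge0 x.
have -> : x - 1 = (Num.sqrt x - 1) * (Num.sqrt x + 1).
  by rewrite -{1}(sqr_sqrtr x0); ring.
by rewrite normrM ler_peMr // ger0_norm; lra.
Qed.

Lemma near_one_sqrt f : near_one f -> near_one (fun M => Num.sqrt (f M)).
Proof.
by move=> [C hC]; exists C => M; apply: le_trans (sqrt_dist1 _) (hC M).
Qed.

Lemma geometric_small C : exists N, forall M, (N <= M)%N -> C * s ^+ M <= 1 / 2.
Proof.
(* Bernoulli's inequality for 1 / s, in a form that allows s = 0. *)
have bern M : s ^+ M * (1 + M%:R * (1 - s)) <= 1.
  elim: M => [|M IH]; first by rewrite expr0; lra.
  apply: le_trans IH; rewrite exprSr -mulrA ler_wpM2l ?exprn_ge0 // -natr1.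
  have : 0 <= M%:R * (1 - s) ^+ 2 :> R by rewrite mulr_ge0 ?sqr_ge0.
  by have := sqr_ge0 (1 - s); lra.
set B := 2 * `|C| / (1 - s).
have B0 : 0 <= B by rewrite divr_ge0 ?mulr_ge0 // subr_ge0 ltW.
exists (Num.bound B) => M NM.
have M_ge : B <= M%:R.
  by rewrite (le_trans (ltW (archi_boundP B0))) // ler_nat.
have K_ge : 2 * C <= M%:R * (1 - s).
  by rewrite (@le_trans _ _ (2 * `|C|)) ?ler_pM2l ?ler_norm // -ler_pdivrMr ?subr_gt0.
have := ler_wpM2l (exprn_ge0 M s_ge0) K_ge.
have := bern M; have := exprn_ge0 M s_ge0; lra.
Qed.


(** Only finitely many terms can be smaller than 1/2; each of them contributes
    one fixed inverse. *)
Lemma near_one_inv_bounded f : near_one f -> bounded (fun M => (f M)^-1).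
Proof.
move=> [C hC]; have [N hN] := geometric_small C.
exists (2 + \sum_(i < N) `|(f i)^-1|) => M.
have [NM|MN] := leqP N M; last first.
  rewrite (bigD1 (Ordinal MN)) //= addrCA lerDl addr_ge0 //.
  by rewrite sumr_ge0.
rewrite (@le_trans _ _ 2) //; last by rewrite lerDl sumr_ge0.
have := le_trans (hC M) (hN M NM); rewrite ler_norml => /andP[lo _].
have f_gt : 1 / 2 <= f M by lra.
rewrite ger0_norm ?invr_ge0; last lra.
by rewrite -[2]invrK lef_pV2 ?posrE; lra.
Qed.

Lemma near_oneV f : near_one f -> near_one (fun M => (f M)^-1).
Proof.
move=> hf; have [B hB] := near_one_inv_bounded hf.
case: hf => C hC; exists ((B + 1) * C) => M.
have B0 := le_trans (normr_ge0 _) (hB M).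
have [f0|f0] := eqVneq (f M) 0.
  (* Since 0^-1 = 0, a vanishing term has the same distance to 1 as its inverse. *)
  rewrite f0 invr0 -f0 -mulrA (le_trans (hC M)) // ler_peMl //; last lra.
  exact: le_trans (hC M).
have -> : (f M)^-1 - 1 = (f M)^-1 * (1 - f M) by field.
rewrite normrM distrC -mulrA ler_pM // (le_trans (hB M)) //; lra.
Qed.

End NearOne.

(** * The invariant plane of the iteration *)

Section Plane.
Variables (R : realType) (n : nat) (A : 'M[R]_n) (phi psi : 'cV[R]_n).
Variables (lam r : R).
Hypotheses (A_phi : A *m phi = lam *: phi) (A_psi : A *m psi = (lam * r) *: psi).
Hypotheses (phi_phi : dotv phi phi = 1) (psi_psi : dotv psi psi = 1).
Hypothesis phi_psi : dotv phi psi = 0.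
Implicit Types (x y : 'cV[R]_n) (a b : R).

Definition in_plane a b : 'cV[R]_n := a *: phi + b *: psi.

Definition rayleigh x : R := dotv (A *m x) x / dotv x x.

Definition residual x : 'cV[R]_n := A *m x - rayleigh x *: x.

Lemma dotvDl x y z : dotv (x + y) z = dotv x z + dotv y z.
Proof. by rewrite /dotv linearD /= mulmxDl mxE. Qed.

Lemma dotvC x y : dotv x y = dotv y x.
Proof. by rewrite /dotv -[x^T *m y]trmxK trmx_mul trmxK mxE. Qed.

Lemma dotvZl a x y : dotv (a *: x) y = a * dotv x y.
Proof. by rewrite /dotv linearZ /= -scalemxAl mxE. Qed.

Lemma dotv_unit x : l2norm x = 1 -> dotv x x = 1.
Proof.
move=> x1; have d_ge0 : 0 <= dotv x x.
  by rewrite /dotv mxE sumr_ge0 // => i _; rewrite mxE -expr2 sqr_ge0.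
by rewrite -(sqr_sqrtr d_ge0) -/(l2norm x) x1 expr1n.
Qed.

Lemma dotv_in_plane a b a' b' :
  dotv (in_plane a b) (in_plane a' b') = a * a' + b * b'.
Proof.
rewrite /in_plane dotvDl !dotvZl !(dotvC _ (_ + _)) !dotvDl !dotvZl.
rewrite phi_phi psi_psi (dotvC psi) phi_psi; ring.
Qed.

Lemma l2norm_in_plane a b : l2norm (in_plane a b) = Num.sqrt (a ^+ 2 + b ^+ 2).
Proof. by rewrite /l2norm dotv_in_plane !expr2. Qed.

Lemma scale_in_plane k a b : k *: in_plane a b = in_plane (k * a) (k * b).
Proof. by rewrite /in_plane scalerDr !scalerA. Qed.

Lemma add_in_plane a b a' b' :
  in_plane a b + in_plane a' b' = in_plane (a + a') (b + b').
Proof. by rewrite /in_plane !scalerDl addrACA. Qed.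

Lemma mul_in_plane a b : A *m in_plane a b = lam *: in_plane a (r * b).
Proof.
rewrite /in_plane mulmxDr -!scalemxAr A_phi A_psi scalerDr !scalerA.
by congr (_ *: _ + _ *: _); ring.
Qed.

(** The residual is orthogonal to the iterate, so in the plane it is a multiple
    of (b, -a); the multiple is lam (1 - r) a b / (a^2 + b^2).  The formula also
    holds at a = b = 0 because 0^-1 = 0. *)
Lemma l2norm_residual a b : 0 <= lam * (1 - r) ->
  l2norm (residual (in_plane a b)) =
    lam * (1 - r) * (`|a| * `|b| / Num.sqrt (a ^+ 2 + b ^+ 2)).
Proof.
move=> gap_ge0; rewrite /residual /rayleigh mul_in_plane scale_in_plane.
rewrite !dotv_in_plane.
rewrite -!expr2; set N := a ^+ 2 + b ^+ 2.
rewrite -scaleN1r !scale_in_plane add_in_plane l2norm_in_plane.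
have [N0|N0] := eqVneq N 0.
  have [a0 b0] : a = 0 /\ b = 0.
    have := sqr_ge0 a; have := sqr_ge0 b; rewrite /N in N0 => b2 a2.
    by split; apply/eqP; rewrite -sqrf_eq0; apply/eqP; lra.
  by rewrite a0 b0 normr0 !(mul0r, mulr0) addr0 expr0n /= addr0 sqrtr0.
have N_gt0 : 0 < N by rewrite lt_def N0 addr_ge0 ?sqr_ge0.
have -> : (lam * a + -1 * ((lam * a * a + lam * (r * b) * b) / N * a)) ^+ 2
    + (lam * (r * b) + -1 * ((lam * a * a + lam * (r * b) * b) / N * b)) ^+ 2
  = (lam * (1 - r) * (a * b)) ^+ 2 / N.
  by rewrite /N in N0 *; field.
rewrite sqrtrM ?sqr_ge0 // sqrtr_sqr sqrtrV ?(ltW N_gt0) //.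
by rewrite normrM (ger0_norm gap_ge0) normrM -[LHS]mulrA.
Qed.

End Plane.

(** * Asymptotics of the combined iteration *)

Definition triangular (j : nat) : nat := \sum_(1 <= l < j.+1) l.

Lemma triangular0 : triangular 0 = 0%N.
Proof. by rewrite /triangular big_geq. Qed.

Lemma triangularS j : triangular j.+1 = (triangular j + j.+1)%N.
Proof. by rewrite /triangular big_nat_recr. Qed.

Section Asymptotics.
Variables (R : realType) (n : nat) (A : 'M[R]_n) (phi psi : 'cV[R]_n).
Variables (lam r c : R).
Hypotheses (A_phi : A *m phi = lam *: phi) (A_psi : A *m psi = (lam * r) *: psi).
Hypotheses (phi_phi : dotv phi phi = 1) (psi_psi : dotv psi psi = 1).
Hypothesis phi_psi : dotv phi psi = 0.
Hypotheses (lam_gt0 : 0 < lam) (r_gt0 : 0 < r) (r_lt1 : r < 1) (c_neq0 : c != 0).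

(** Counting from M = m - 1 makes the error scale r^(2(m-1)) a plain power and
    avoids truncated subtraction: the first iterate that matters is x_M. *)
Definition run (M : nat) (I : iterates R n) : Prop :=
  combined_iteration A (phi + c *: psi) M.+1 I.

(** The relative factor is chosen before the run, so that its error constant
    holds for every run with the same [M]. *)
Definition scal_asymp (F : nat -> iterates R n -> R) (w : nat -> R) : Prop :=
  exists2 g, near_one (r ^+ 2) g & forall M I, run M I -> F M I = w M * g M.

Definition vec_asymp (F : nat -> iterates R n -> 'cV[R]_n) (a : R) (e : nat) :=
  exists p q, [/\ near_one (r ^+ 2) p, near_one (r ^+ 2) q
    & forall M I, run M I ->
        F M I = a *: in_plane phi psi (p M) (c * r ^+ (M + e) * q M)].

Let s_ge0 : 0 <= r ^+ 2. Proof. exact: sqr_ge0. Qed.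
Let s_lt1 : r ^+ 2 < 1. Proof. by rewrite expr_lt1 // ltW. Qed.

(** The psi-coordinate enters squared, and r^(2(M+e)) is itself O(r^(2M)); this
    is where the error order comes from. *)
Lemma plane_norm_near_one e p q :
  near_one (r ^+ 2) p -> near_one (r ^+ 2) q ->
  near_one (r ^+ 2)
    (fun M => Num.sqrt (p M ^+ 2 + (c * r ^+ (M + e) * q M) ^+ 2)).
Proof.
move=> hp hq; apply: near_one_sqrt.
have hq2 := near_one_bounded s_ge0 s_lt1 (near_oneM s_ge0 s_lt1 hq hq).
have hO := geomOMl (boundedM (bounded_cst ((c * r ^+ e) ^+ 2)) hq2)
  (geomO_expr s_ge0).
have := near_oneD (near_oneM s_ge0 s_lt1 hp hp) hO.
apply: near_one_ext => M; rewrite exprD exprAC; ring.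
Qed.

Lemma vec_asymp_normalize F G a e : 0 < a -> vec_asymp F a e ->
  (forall M I, run M I -> G M I = (l2norm (F M I))^-1 *: F M I) ->
  vec_asymp G 1 e.
Proof.
move=> a_gt0 [p [q [hp hq hF]]] hG.
have hN := near_oneV s_ge0 s_lt1 (plane_norm_near_one e hp hq).
set N := (fun M => _^-1) in hN.
exists (fun M => N M * p M), (fun M => N M * q M).
split; [exact: near_oneM|exact: near_oneM|move=> M I runI].
rewrite hG // (hF _ _ runI) {1}scale_in_plane.
rewrite (l2norm_in_plane phi_phi psi_psi phi_psi).
have -> : (a * p M) ^+ 2 + (a * (c * r ^+ (M + e) * q M)) ^+ 2
   = a ^+ 2 * (p M ^+ 2 + (c * r ^+ (M + e) * q M) ^+ 2) by ring.
rewrite sqrtrM ?sqr_ge0 // sqrtr_sqr gtr0_norm // invfM -/(N M).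
rewrite scalerA scale1r mulrAC mulVf ?gt_eqF // mul1r scale_in_plane.
by congr in_plane; ring.
Qed.

Lemma vec_asymp_mul Y U e : vec_asymp Y 1 e ->
  (forall M I, run M I -> U M I = A *m Y M I) -> vec_asymp U lam e.+1.
Proof.
move=> [p [q [hp hq hY]]] hU; exists p, q; split=> // M I runI.
rewrite hU // (hY _ _ runI) scale1r (mul_in_plane A_phi A_psi).
by rewrite addnS exprS; congr (_ *: in_plane _ _ _ _); ring.
Qed.

(** The phi-coordinate and the norm of y are both close to 1, so the residual
    norm retains only the gap lam (1 - r) and the psi-coordinate of y. *)
Lemma residual_asymp Y D e : vec_asymp Y 1 e ->
  (forall M I, run M I -> D M I = residual A (Y M I)) ->
  scal_asymp (fun M I => l2norm (D M I))
    (fun M => lam * (1 - r) * `|c| * r ^+ (M + e)).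
Proof.
move=> [p [q [hp hq hY]]] hD.
have hN := near_oneV s_ge0 s_lt1 (plane_norm_near_one e hp hq).
have hpq := near_oneM s_ge0 s_lt1 (near_one_norm hp)
  (near_one_norm hq).
have hg := near_oneM s_ge0 s_lt1 hpq hN.
eexists; first exact: hg.
move=> M I runI; rewrite hD // (hY _ _ runI) scale1r.
rewrite (l2norm_residual A_phi A_psi phi_phi psi_psi phi_psi).
  rewrite !normrM (ger0_norm (exprn_ge0 _ (ltW r_gt0))) /=; ring.
by rewrite mulr_ge0 ?subr_ge0 ?ltW.
Qed.

(** Relative to c r^(M+e+i), the psi-coordinate of y is
    (1 + r^i g) q - g q' = r^i g q + (q - g q'): the second part is an error
    term, so the leading term is smaller by a further factor r^i. *)
Lemma vec_asymp_extrapolate X X' gam Y e i :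
  vec_asymp X 1 (e + i) -> vec_asymp X' 1 e ->
  scal_asymp gam (fun=> - r ^+ i) ->
  (forall M I, run M I ->
    Y M I = (1 - gam M I) *: X M I + gam M I *: X' M I) ->
  vec_asymp Y 1 (e + i + i).
Proof.
move=> [p [q [hp hq hX]]] [p' [q' [hp' hq' hX']]] [g hg hgam] hY.
have ri_neq0 : r ^+ i != 0 by rewrite expf_neq0 ?gt_eqF.
have bg := near_one_bounded s_ge0 s_lt1 hg.
have hgM := near_oneM s_ge0 s_lt1 hg.
exists (fun M => p M + r ^+ i * g M * (p M - p' M)),
       (fun M => g M * q M + (r ^+ i)^-1 * (q M - g M * q' M)); split.
- apply: near_oneD => //; apply: geomOMl; last exact: near_oneB.
  by apply: boundedM => //; apply: bounded_cst.
- apply: near_oneD; first exact: hgM.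
  by apply: geomOMl; [exact: bounded_cst|apply: near_oneB => //; exact: hgM].
move=> M I runI; rewrite hY // (hX _ _ runI) (hX' _ _ runI) (hgam _ _ runI).
rewrite !scale1r !scale_in_plane add_in_plane !addnA !(exprD _ _ i).
by congr in_plane; [ring|field].
Qed.

Lemma run_common M I k : run M I ->
  [/\ it_x I k = (it_h I k)^-1 *: it_u I k, it_h I k = l2norm (it_u I k)
    & it_v I k.+1 = A *m it_x I k].
Proof.
case=> u0 h0 hpow hext.
have stepE i : [/\ it_x I i = (it_h I i)^-1 *: it_u I i,
    it_h I i.+1 = l2norm (it_u I i.+1) & it_v I i.+1 = A *m it_x I i].
  have [/hpow|/hext] := leqP i M.+1; case: I {u0 h0 hpow hext} => x u v h l d g y /=.
  + by case=> -> [-> [-> [-> _]]].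
  + by case=> -> [-> [_ [_ [-> _]]]].
have [xE _ vE] := stepE k; split=> //.
by case: k {xE vE} => [|k]; [rewrite h0 u0|have [] := stepE k].
Qed.

Lemma run_power M I k : run M I -> (k <= M.+1)%N ->
  [/\ it_u I k.+1 = A *m it_x I k
    & it_d I k.+1 = it_u I k.+1 - dotv (it_u I k.+1) (it_x I k) *: it_x I k].
Proof.
case=> _ _ hpow _ /hpow; case: I {hpow} => x u v h l d g y /=.
by case=> _ [-> [-> [_ [-> ->]]]].
Qed.

(** The stored vectors v_k are images under A, so combining v_(k+1) and v_k
    amounts to applying A to the extrapolated vector; hence d_(k+1) is its
    residual. *)
Lemma run_extrapolation M I k : run M I -> (M.+1 < k)%N ->
  let y := (1 - it_gam I k) *: it_x I k + it_gam I k *: it_x I k.-1 in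
  [/\ it_gam I k = - (l2norm (it_d I k) / l2norm (it_d I k.-1)),
      it_u I k.+1 = A *m y & it_d I k.+1 = residual A y].
Proof.
move=> runI Mk y.
have [_ _ vE] := run_common k runI; have [_ _ vE'] := run_common k.-1 runI.
rewrite prednK ?(ltn_trans _ Mk) // in vE'.
have uE : (1 - it_gam I k) *: it_v I k.+1 + it_gam I k *: it_v I k = A *m y.
  by rewrite vE vE' /y mulmxDr -!scalemxAr.
move: uE; rewrite /y {y vE vE'}; case: runI => _ _ _ /(_ k Mk).
case: I => x u v h l d g xg /= [_ [_ [-> [-> [_ [-> [-> ->]]]]]]] ->.
by split.
Qed.

Lemma power_x M I k : run M I -> (k <= M.+1)%N ->
  it_x I k =
    (Num.sqrt (1 + (c * r ^+ k) ^+ 2))^-1 *: in_plane phi psi 1 (c * r ^+ k).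
Proof.
move=> runI kM.
(* Normalisation forgets the positive factor accumulated by the iteration. *)
suff [a a_gt0 uE] :
    exists2 a, 0 < a & it_u I k = a *: in_plane phi psi 1 (c * r ^+ k).
  have [xE hE _] := run_common k runI.
  rewrite xE hE uE {1}scale_in_plane.
  rewrite (l2norm_in_plane phi_phi psi_psi phi_psi).
  rewrite mulr1 exprMn -{1}[a ^+ 2]mulr1 -mulrDr sqrtrM ?sqr_ge0 //.
  rewrite sqrtr_sqr gtr0_norm // invfM scalerA mulrAC mulVf ?gt_eqF //.
  by rewrite mul1r.
elim: k kM => [|k IH] kM.
  exists 1 => //; case: runI => -> _ _ _.
  by rewrite /in_plane expr0 mulr1 !scale1r.
have [a a_gt0 uE] := IH (ltnW kM); have [-> _] := run_power runI (ltnW kM).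
have [-> -> _] := run_common k runI.
rewrite uE scalerA -scalemxAr (mul_in_plane A_phi A_psi) scalerA.
exists (((l2norm (a *: in_plane phi psi 1 (c * r ^+ k)))^-1 * a * lam)).
  rewrite !mulr_gt0 // invr_gt0 scale_in_plane.
  rewrite (l2norm_in_plane phi_phi psi_psi phi_psi) sqrtr_gt0 mulr1.
  by rewrite ltr_wpDr ?sqr_ge0 ?exprn_gt0.
by congr (_ *: in_plane _ _ _ _); rewrite exprS; ring.
Qed.

Lemma power_x_asymp a : (a <= 1)%N -> vec_asymp (fun M I => it_x I (M + a)) 1 a.
Proof.
move=> a_le1; have h1 := near_one_cst1 (r ^+ 2).
have hN := near_oneV s_ge0 s_lt1 (plane_norm_near_one a h1 h1).
set N := fun M => (Num.sqrt (1 + (c * r ^+ (M + a)) ^+ 2))^-1.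
have hN' : near_one (r ^+ 2) N.
  by apply: near_one_ext hN => M; rewrite /N expr1n mulr1.
exists N, N; split=> // M I runI.
have -> := power_x (k := M + a) runI; last by rewrite -addn1 leq_add2l.
rewrite -/(N M) scale1r scale_in_plane mulr1.
by congr in_plane; rewrite mulrC.
Qed.

Lemma power_d_asymp a : (a <= 1)%N ->
  scal_asymp (fun M I => l2norm (it_d I (M + a).+1))
    (fun M => lam * (1 - r) * `|c| * r ^+ (M + a)).
Proof.
move=> a_le1; apply: residual_asymp (power_x_asymp a_le1) _ => M I runI.
have aM : (M + a <= M.+1)%N by rewrite -addn1 leq_add2l.
have [uE ->] := run_power runI aM.
rewrite /residual /rayleigh -uE (power_x runI aM).
set N2 := 1 + _ ^+ 2.
(* Power iterates are unit vectors, so the undivided quotient of the power phase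
   is the Rayleigh quotient. *)
have N2_gt0 : 0 < N2 by rewrite ltr_wpDr ?sqr_ge0.
rewrite scale_in_plane (dotv_in_plane phi_phi psi_psi phi_psi).
have -> : (Num.sqrt N2)^-1 * 1 * ((Num.sqrt N2)^-1 * 1) +
   (Num.sqrt N2)^-1 * (c * r ^+ (M + a)) * ((Num.sqrt N2)^-1 * (c * r ^+ (M + a)))
   = N2 / Num.sqrt N2 ^+ 2.
  by rewrite [in N2 / _]/N2; field; rewrite gt_eqF ?sqrtr_gt0.
by rewrite sqr_sqrtr ?(ltW N2_gt0) // divff ?gt_eqF // divr1.
Qed.

(** What the next extrapolation step consumes: the new iterate before its
    normalisation, the last normalised one, and two residuals. *)
Record state_asymp (j : nat) : Prop := StateAsymp {
  state_u : vec_asymp (fun M I => it_u I (M + j.+2)) lam (triangular j.+1).+1;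
  state_x : vec_asymp (fun M I => it_x I (M + j.+1)) 1 (triangular j).+1;
  state_d : scal_asymp (fun M I => l2norm (it_d I (M + j.+2)))
    (fun M => lam * (1 - r) * `|c| * r ^+ (M + triangular j.+1));
  state_d_prev : scal_asymp (fun M I => l2norm (it_d I (M + j.+1)))
    (fun M => lam * (1 - r) * `|c| * r ^+ (M + triangular j))
}.

Lemma state_asymp0 : state_asymp 0.
Proof.
have x1 := power_x_asymp (a := 1%N) isT.
have t1 : triangular 1 = 1%N by rewrite triangularS triangular0.
split; rewrite ?t1 ?triangular0 //.
- apply: vec_asymp_mul x1 _ => M I runI.
  by rewrite addnS; case: (run_power (k := M + 1) runI); rewrite ?addn1.
- have [g hg hE] := power_d_asymp (a := 1%N) isT; exists g => // M I runI.
  by rewrite addnS hE.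
- have [g hg hE] := power_d_asymp (a := 0%N) isT; exists g => // M I runI.
  by rewrite addnS hE.
Qed.

(** The residual exponents T_(j+1) and T_j differ by j + 1. *)
Lemma gam_asymp j : state_asymp j ->
  scal_asymp (fun M I => it_gam I (M + j.+2)) (fun=> - r ^+ j.+1).
Proof.
move=> [_ _ [g hg hd] [g' hg' hd']].
exists (fun M => g M * (g' M)^-1).
  by apply: near_oneM => //; apply: near_oneV.
move=> M I runI; have Mk : (M.+1 < M + j.+2)%N by rewrite !addnS !ltnS leq_addr.
have [-> _ _] := run_extrapolation runI Mk.
rewrite (hd _ _ runI) addnS /= (hd' _ _ runI) triangularS addnA exprD invfM.
have k_neq0 : lam * (1 - r) * `|c| * r ^+ (M + triangular j) != 0.
  by rewrite gt_eqF // !mulr_gt0 ?exprn_gt0 ?subr_gt0 ?normr_gt0.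
rewrite mulrA; set k := (X in X != 0) in k_neq0 *; rewrite -/k.
by move: (g' M)^-1 => h; field.
Qed.

Lemma state_asympS j : state_asymp j -> state_asymp j.+1.
Proof.
move=> st; have gamE := gam_asymp st; case: st => hu hx hd _.
have hx' : vec_asymp (fun M I => it_x I (M + j.+2)) 1 (triangular j.+1).+1.
  apply: vec_asymp_normalize lam_gt0 hu _ => M I runI.
  by have [-> -> _] := run_common (M + j.+2) runI.
have hx'' := hx'; rewrite triangularS -addSn in hx''.
have Mk M : (M.+1 < M + j.+2)%N by rewrite !addnS !ltnS leq_addr.
have step M I (runI : run M I) := run_extrapolation runI (Mk M).
have hy := vec_asymp_extrapolate hx'' hx gamE (fun _ _ _ => erefl).
have eE : ((triangular j).+1 + j.+1 + j.+1 = triangular j.+2)%N.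
  by rewrite !triangularS; lia.
rewrite eE in hy.
split=> //.
- apply: vec_asymp_mul hy _ => M I runI.
  by rewrite [(M + j.+3)%N]addnS; have [_ -> _] := step _ _ runI; rewrite addnS.
- apply: residual_asymp hy _ => M I runI.
  by rewrite [(M + j.+3)%N]addnS; have [_ _ ->] := step _ _ runI; rewrite addnS.
Qed.

Lemma state_asymp_all j : state_asymp j.
Proof. by elim: j => [|j]; [exact: state_asymp0|exact: state_asympS]. Qed.

End Asymptotics.

Unset Implicit Arguments.
Set Strict Implicit.
Set Printing Implicit Defensive.

Theorem theorem1 (R : realType) (n : nat) (A : 'M[R]_n)
    (phi psi : 'cV[R]_n) (lam mu r c : R)
    (A_psd : psd A)
    (lam_mu : first_two_eigenvalues A lam mu)
    (A_phi : A *m phi = lam *: phi) (A_psi : A *m psi = mu *: psi)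
    (phi_unit : l2norm phi = 1) (psi_unit : l2norm psi = 1)
    (phi_psi : dotv phi psi = 0)
    (r_def : r = mu / lam) (r_gt : 1 / 2 < r)
    (c_neq0 : c != 0) :
  forall j : nat, (1 <= j)%N ->
  exists Ceps Ctheta Ceta : R,
  forall (m : nat) (I : iterates R n), (1 <= m)%N ->
    c ^+ 2 * r ^+ (2 * (m - 1)) * (1 - r ^+ 2) < 1 ->
    combined_iteration A (phi + c *: psi) m I ->
    defined_upto m I (m + j + 1) ->
  exists eps theta eta : R,
    [/\ it_gam I (m + j) = - r ^+ j * (1 + eps),
        it_u I (m + j + 1) =
          lam *: ((1 + theta) *: phi
                  + (c * r ^+ (m + \sum_(1 <= l < j.+2) l) * (1 + eta)) *: psi),
        `|eps| <= Ceps * r ^+ (2 * (m - 1)),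
        `|theta| <= Ctheta * r ^+ (2 * m + 1)
      & `|eta| <= Ceta * r ^+ (2 * (m - 1))].
Proof.
have phi_phi := dotv_unit phi_unit; have psi_psi := dotv_unit psi_unit.
have lam_ge0 : 0 <= lam.
  by have [_ /(_ phi)] := A_psd; rewrite A_phi dotvC dotvZl phi_phi mulr1.
have lam_neq0 : lam != 0.
  by apply: contraTneq r_gt => l0; rewrite r_def l0 invr0 mulr0 -leNgt; lra.
have lam_gt0 : 0 < lam by rewrite lt_def lam_neq0.
have r_gt0 : 0 < r by lra.
have r_lt1 : r < 1.
  by have [_ _ mu_lt _ _] := lam_mu; rewrite r_def ltr_pdivrMr // mul1r.
have A_psi' : A *m psi = (lam * r) *: psi.
  by rewrite A_psi r_def mulrC divfK.
case=> // i _.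
have state := state_asymp_all A_phi A_psi' phi_phi psi_psi phi_psi
  lam_gt0 r_gt0 r_lt1 c_neq0.
have [g [Ceps hg] gamE] := gam_asymp lam_gt0 r_gt0 r_lt1 c_neq0 (state i).
have [p [q [[Ctheta hp] [Ceta hq] uE]]] := state_u (state i.+1).
exists Ceps, (Ctheta / r ^+ 3), Ceta => -[//|M] I _ _ runI _.
exists (g M - 1), (p M - 1), (q M - 1).
have idx : (M.+1 + i.+1 = M + i.+2)%N by rewrite addSnnS.
have idx' : (M + i.+2 + 1 = M + i.+3)%N by rewrite addn1 -addnS.
rewrite idx idx' subn1 /= exprM !(addrC 1) !subrK; split=> //.
- exact: gamE.
- by rewrite uE // -/(triangular i.+2) addSnnS.
- have -> : (2 * M.+1 + 1 = 3 + 2 * M)%N by rewrite mulnS; lia.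
  by rewrite exprD exprM mulrA divfK // expf_neq0 ?gt_eqF.
Qed.
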